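(* Let $\Gamma$ be an abelian group, $H=\Bbbk\Gamma$, and $V\in{}^H_H\mathcal{YD}$ with a basis $x_1,\dots,x_n$ such that for some $g_1,\dots,g_n\in\Gamma$ and characters $\chi_1,\dots,\chi_n\in\widehat\Gamma$ one has $h.x_j=\chi_j(h)x_j$ and $\delta(x_j)=g_j\otimes x_j$ for all $h\in\Gamma$, $1\le j\le n$. Assume $\chi_i\neq\varepsilon$ for all $i$ and $(g_i,\chi_i)\ne(g_j,\chi_j)$ for all $i\ne j$. Then there is a bijective correspondence between the Hopf algebra automorphisms of $\mathfrak B(V)\#\Bbbk\Gamma$ and the set of pairs $(\phi,\psi)$ where $\psi$ is a group automorphism of $\Gamma$ and $\phi:V\to V$ is a linear isomorphism $\phi(x_i)=\lambda_ix_{\sigma(i)}$ with $\lambda_i\in\Bbbk^\times$, $\sigma\in\mathbb S_n$, satisfying $\psi(g_i)=g_{\sigma(i)}$ and $\chi_i=\chi_{\sigma(i)}\circ\psi$ for all $1\le i\le n$. The automorphism corresponding to $(\phi,\psi)$ is $\mathfrak B(\phi)\otimes T_\psi$, where $\mathfrak B(\phi)$ is the algebra automorphism of $\mathfrak B(V)$ extending $\phi$ and $T_\psi$ the Hopf automorphism of $\Bbbk\Gamma$ extending $\psi$.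
   Context: $\varepsilon$ denotes the trivial character of $\Gamma$. Yetter–Drinfeld modules over $H$: left $H$-module and comodule with $\delta(h.v)=h_{(1)}v_{(-1)}\mathcal S(h_{(3)})\otimes h_{(2)}.v_{(0)}$, braided by $c(v\otimes w)=v_{(-1)}.w\otimes v_{(0)}$ (here $c(x_i\otimes x_j)=\chi_j(g_i)x_j\otimes x_i$). $\mathfrak B(V)=\bigoplus_{n\ge 0}\mathfrak B^n(V)$ is the Nichols algebra of $V$: the graded Hopf algebra in ${}^H_H\mathcal{YD}$ with $\mathfrak B^0=\Bbbk$, $\mathfrak B^1\simeq V$, generated by $V$, whose primitive elements are exactly $V$. The bosonization $\mathfrak B(V)\#H$ has underlying space $\mathfrak B(V)\otimes H$, product $(r\#h)(s\#f)=r(h_{(1)}.s)\#h_{(2)}f$ and coproduct $\Delta(r\#h)=r^{(1)}\#(r^{(2)})_{(-1)}h_{(1)}\otimes(r^{(2)})_{(0)}\#h_{(2)}$. *)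

(* Defs.v *)
From HB Require Import structures.
From mathcomp Require Import all_boot all_order all_fingroup all_algebra.
Set Implicit Arguments. Unset Strict Implicit. Unset Printing Implicit Defensive.
Import GRing.Theory.
Local Open Scope ring_scope.

Section Bosonization.
Variables (k : fieldType) (G : zmodType) (n : nat).
(* x_i has degree g i and weight chi i:  h.x_i = chi i h x_i, delta x_i = g_i (x) x_i *)
Variables (g : 'I_n -> G) (chi : 'I_n -> G -> k).

(* words x_{w_1} ... x_{w_m} in the tensor algebra T(V) *)
Definition word := seq 'I_n.
(* basis symbols  w # gamma  of T(V) # kG *)
Definition basisA := (word * G)%type.
(* formal finite linear combinations (elements of T(V)#kG, resp. its tensor square) *)
Definition FS := seq (k * basisA).
Definition FS2 := seq (k * (basisA * basisA)).

(* braiding  c(x_i (x) x_j) = chi_j(g_i) x_j (x) x_i *)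
Definition qb (i j : 'I_n) : k := chi j (g i).

(* Matsumoto lift T_s of s in S_m: the letter at position a moves to s a *)
Definition permw (w : word) (s : 'S_(size w)) : word :=
  [seq tnth (in_tuple w) ((s^-1)%g j) | j <- enum 'I_(size w)].
Definition symcoef (w : word) (s : 'S_(size w)) : k :=
  \prod_(a < size w) \prod_(b < size w | (a < b)%N && (s b < s a)%N)
     qb (tnth (in_tuple w) a) (tnth (in_tuple w) b).
(* coefficient of x_u in Omega_m(x_w), Omega_m = sum_{s in S_m} T_s the
   quantum symmetrizer; B^m(V) = T^m(V) / ker Omega_m *)
Definition Omega (w u : word) : k :=
  \sum_(s : 'S_(size w) | permw s == u) symcoef s.

(* f represents 0 in B(V) # kG  (= B(V) (x) kG as a vector space) *)
Definition zeroA (f : FS) : Prop :=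
  forall (gam : G) (u : word),
    \sum_(p <- f | p.2.2 == gam) p.1 * Omega p.2.1 u = 0.
Definition eqA (f f' : FS) : Prop := zeroA (f ++ [seq (- p.1, p.2) | p <- f']).
(* f represents 0 in (B(V)#kG) (x) (B(V)#kG) *)
Definition zeroAA (f : FS2) : Prop :=
  forall (gam del : G) (u v : word),
    \sum_(p <- f | (p.2.1.2 == gam) && (p.2.2.2 == del))
       p.1 * Omega p.2.1.1 u * Omega p.2.2.1 v = 0.
Definition eqAA (f f' : FS2) : Prop := zeroAA (f ++ [seq (- p.1, p.2) | p <- f']).

Definition basis_of (b : basisA) : FS := [:: (1, b)].
Definition unitA : FS := [:: (1, ([::], 0))].

(* product:  (w # a)(w' # b) = (a . w') w' ... = chi_{w'}(a) w w' # (a + b) *)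
Definition chiw (w : word) (a : G) : k := \prod_(i <- w) chi i a.
Definition mulB (b b' : basisA) : FS :=
  [:: (chiw b'.1 b.2, (b.1 ++ b'.1, b.2 + b'.2))].
Definition mulA (f f' : FS) : FS :=
  flatten [seq [seq (p.1 * p'.1 * q.1, q.2) | q <- mulB p.2 p'.2] | p <- f, p' <- f'].

(* coproduct: Delta(x_i # 0) = x_i # 0 (x) 1 # 0 + 1 # g_i (x) x_i # 0,
   Delta(1 # a) = 1 # a (x) 1 # a, extended multiplicatively *)
Definition bitsS (w : word) (X : {set 'I_(size w)}) : bitseq :=
  [seq (j \in X) | j <- enum 'I_(size w)].
Definition coefD (w : word) (X : {set 'I_(size w)}) : k :=
  \prod_(j < size w | j \notin X) \prod_(l < size w | (j < l)%N && (l \in X))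
     chi (tnth (in_tuple w) l) (g (tnth (in_tuple w) j)).
Definition gsum (w : word) (X : {set 'I_(size w)}) : G :=
  \sum_(j < size w | j \notin X) g (tnth (in_tuple w) j).
Definition DeltaB (b : basisA) : FS2 :=
  [seq (coefD X, ((mask (bitsS X) b.1, gsum X + b.2),
                  (mask (map negb (bitsS X)) b.1, b.2)))
  | X : {set 'I_(size b.1)}].
Definition DeltaA (f : FS) : FS2 :=
  flatten [seq [seq (p.1 * q.1, q.2) | q <- DeltaB p.2] | p <- f].

Definition epsB (b : basisA) : k := if b.1 is [::] then 1 else 0.
Definition epsA (f : FS) : k := \sum_(p <- f) p.1 * epsB p.2.

(* k-linear maps given on basis symbols *)
Definition linmap := basisA -> FS.
Definition applyL (F : linmap) (f : FS) : FS :=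
  flatten [seq [seq (p.1 * q.1, q.2) | q <- F p.2] | p <- f].
Definition applyL2 (F : linmap) (f : FS2) : FS2 :=
  flatten [seq [seq (p.1 * a.1 * b.1, (a.2, b.2)) | a <- F p.2.1, b <- F p.2.2]
          | p <- f].

Definition well_defined (F : linmap) : Prop :=
  forall f, zeroA f -> zeroA (applyL F f).
Definition eqL (F F' : linmap) : Prop := forall b, eqA (F b) (F' b).

Definition is_hopf_aut (F : linmap) : Prop :=
  well_defined F /\
  [/\ (exists F' : linmap, [/\ well_defined F',
         (forall b, eqA (applyL F' (F b)) (basis_of b)) &
         (forall b, eqA (applyL F (F' b)) (basis_of b))]),
      eqA (applyL F unitA) unitA,
      (forall b b', eqA (applyL F (mulB b b')) (mulA (F b) (F b'))),
      (forall b, eqAA (DeltaA (F b)) (applyL2 F (DeltaB b))) &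
      (forall b, epsA (F b) = epsB b)].

(* the pair (phi, psi): phi(x_i) = lam_i x_{sig i}, psi a group automorphism *)
Definition admissible (lam : 'I_n -> k) (sig : {perm 'I_n}) (psi : G -> G) : Prop :=
  [/\ (forall i, lam i != 0),
      (forall a b, psi (a + b) = psi a + psi b),
      bijective psi,
      (forall i, psi (g i) = g (sig i)) &
      forall i, chi i = chi (sig i) \o psi].

Definition Phi (lam : 'I_n -> k) (sig : {perm 'I_n}) (psi : G -> G) : linmap :=
  fun b => [:: (\prod_(i <- b.1) lam i, (map sig b.1, psi b.2))].

End Bosonization.

(* Main.v *)
(* The functionals u |-> Omega(w, u) satisfy Omega(w, a u) = Omega(d_a w, u) for the
   skew derivations d_a of the tensor algebra, so a formal sum vanishes in B(V) # kG
   exactly when all its coefficients c(gamma, u) do, and in these coordinates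
   Delta reads c(gamma, u; delta, v) = [gamma = g_v + delta] c(delta, u v),
   g_v being the sum of the g_i over the letters of v.
   Comparing coefficients, a grouplike element is some gamma in G, so an automorphism
   F permutes G by some psi.  Similarly F(x_i), being skew primitive, only has
   coefficients at words of length at most one; conjugation by G kills the one at the
   empty word, as chi_i is nontrivial, and forces psi(g_i) = g_j and
   chi_i = chi_j o psi whenever x_j occurs.  By distinctness of the pairs (g_j, chi_j)
   a single j occurs, and j = sigma(i) is injective. *)
Require Import Defs.
From HB Require Import structures.
From mathcomp Require Import all_boot all_order all_fingroup all_algebra.
From Stdlib Require Import FunctionalExtensionality Classical_Prop.
Import GRing.Theory.
Local Open Scope ring_scope.

Set Implicit Arguments.
Unset Strict Implicit.
Unset Printing Implicit Defensive.

(** * Pairing formal linear combinations with functionals *)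

Section Evaluation.
Variable k : fieldType.

(** A function on basis symbols stands for its linear extension, so that equality modulo the
    relations can be tested in [k], one functional at a time. *)
Definition ev (T : Type) (f : seq (k * T)) (phi : T -> k) : k :=
  \sum_(p <- f) p.1 * phi p.2.

Lemma ev_nil T (phi : T -> k) : ev [::] phi = 0.
Proof. by rewrite /ev big_nil. Qed.

Lemma ev_cons T p (f : seq (k * T)) phi : ev (p :: f) phi = p.1 * phi p.2 + ev f phi.
Proof. by rewrite /ev big_cons. Qed.

Lemma ev1 T c (b : T) phi : ev [:: (c, b)] phi = c * phi b.
Proof. by rewrite ev_cons ev_nil addr0. Qed.

Lemma ev_cat T (f f' : seq (k * T)) phi : ev (f ++ f') phi = ev f phi + ev f' phi.
Proof. by rewrite /ev big_cat. Qed.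

Lemma ev_opp T (f : seq (k * T)) phi :
  ev [seq (- p.1, p.2) | p <- f] phi = - ev f phi.
Proof. by rewrite /ev big_map -sumrN; apply: eq_bigr => p _; rewrite mulNr. Qed.

Lemma eq_ev T (f : seq (k * T)) phi phi' : phi =1 phi' -> ev f phi = ev f phi'.
Proof. by move=> e; apply: eq_bigr => p _; rewrite e. Qed.

Lemma eq_ev_in (T : eqType) (f : seq (k * T)) phi phi' :
  (forall p, p \in f -> phi p.2 = phi' p.2) -> ev f phi = ev f phi'.
Proof. by move=> e; apply: eq_big_seq => p /e ->. Qed.

Lemma evD T (f : seq (k * T)) phi phi' :
  ev f (fun b => phi b + phi' b) = ev f phi + ev f phi'.
Proof. by rewrite /ev -big_split; apply: eq_bigr => p _; rewrite mulrDr. Qed.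

Lemma evZl T (f : seq (k * T)) c phi : ev f (fun b => c * phi b) = c * ev f phi.
Proof. by rewrite /ev mulr_sumr; apply: eq_bigr => p _; rewrite mulrCA. Qed.

Lemma evZr T (f : seq (k * T)) c phi : ev f (fun b => phi b * c) = ev f phi * c.
Proof. by rewrite /ev mulr_suml; apply: eq_bigr => p _; rewrite mulrA. Qed.

Lemma ev_exchange T T' (f : seq (k * T)) (f' : seq (k * T')) phi :
  ev f (fun b => ev f' (fun b' => phi b b')) =
  ev f' (fun b' => ev f (fun b => phi b b')).
Proof.
rewrite /ev; under eq_bigr do rewrite mulr_sumr.
under [RHS]eq_bigr do rewrite mulr_sumr.
by rewrite exchange_big; apply: eq_bigr => p _; apply: eq_bigr => q _; rewrite mulrCA.
Qed.

Lemma ev_map S T (h : S -> k * T) (f : seq S) phi :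
  ev [seq h p | p <- f] phi = \sum_(p <- f) (h p).1 * phi (h p).2.
Proof. by rewrite /ev big_map. Qed.

Lemma ev_neq0 (T : eqType) (f : seq (k * T)) phi :
  ev f phi != 0 -> exists2 p, p \in f & phi p.2 != 0.
Proof.
move=> nz; have [/hasP //|/hasPn z] := boolP (has (fun p => phi p.2 != 0) f).
case/eqP: nz; rewrite /ev big_seq big1 // => p /z; rewrite negbK => /eqP ->.
by rewrite mulr0.
Qed.

End Evaluation.

(** * Skew derivations and unshuffles in the tensor algebra *)

Section FreeAlgebra.
Variables (k : fieldType) (n : nat).
Implicit Types (q : 'I_n -> 'I_n -> k) (w u v : seq 'I_n).

(** The skew derivation [d_a]: each occurrence of [a] is braided to the front past the letters
    before it, then removed. *)
Fixpoint skew_deriv q (a : 'I_n) w : seq (k * seq 'I_n) :=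
  if w is i :: w' then
    (if i == a then [:: (1, w')] else [::]) ++
    [seq (q i a * p.1, i :: p.2) | p <- skew_deriv q a w']
  else [::].

(** The braided coproduct of the tensor algebra: a letter going to the right factor passes the later
    letters that go to the left one. *)
Fixpoint unshuffle q w : seq (k * (seq 'I_n * seq 'I_n)) :=
  if w is i :: w' then
    [seq (p.1, (i :: p.2.1, p.2.2)) | p <- unshuffle q w'] ++
    [seq ((\prod_(l <- p.2.1) q i l) * p.1, (p.2.1, i :: p.2.2))
    | p <- unshuffle q w']
  else [:: (1, ([::], [::]))].

(** The quantum symmetrizer by recursion on the target word; [Omega_ord_Om] identifies it with the
    sum over permutations. *)
Fixpoint Om q w u : k :=
  if u is a :: u' then ev (skew_deriv q a w) (fun w' => Om q w' u') else (w == [::])%:R.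

Lemma ev_skew_deriv_cons q a i w phi :
  ev (skew_deriv q a (i :: w)) phi =
  (i == a)%:R * phi w + q i a * ev (skew_deriv q a w) (fun w' => phi (i :: w')).
Proof.
rewrite /= ev_cat; congr (_ + _).
  by case: eqP; rewrite ?ev1 ?ev_nil ?mul0r.
by rewrite ev_map /ev mulr_sumr; apply: eq_bigr => p _; rewrite mulrA.
Qed.

Lemma ev_unshuffle_cons q i w phi :
  ev (unshuffle q (i :: w)) phi =
  ev (unshuffle q w) (fun b => phi (i :: b.1, b.2)) +
  ev (unshuffle q w) (fun b => (\prod_(l <- b.1) q i l) * phi (b.1, i :: b.2)).
Proof.
rewrite /= ev_cat !ev_map; congr (_ + _).
by apply: eq_bigr => p _ /=; rewrite -mulrA mulrCA.
Qed.

Lemma skew_deriv_perm q a w p : p \in skew_deriv q a w -> perm_eq w (a :: p.2).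
Proof.
elim: w p => [|i w IH] p //=; rewrite mem_cat => /orP[].
  by case: eqP => // ->; rewrite inE => /eqP ->.
case/mapP => p' /IH pe ->.
rewrite -cat1s -[a :: _]cat1s -[i :: p'.2]cat1s perm_sym perm_catCA perm_cat2l perm_sym.
exact: pe.
Qed.

Lemma unshuffle_perm q w p : p \in unshuffle q w -> perm_eq w (p.2.1 ++ p.2.2).
Proof.
elim: w p => [|i w IH] p //=; first by rewrite inE => /eqP ->.
rewrite mem_cat => /orP[] /mapP[p' /IH pe ->] /=; first by rewrite perm_cons.
rewrite -[i :: w]cat1s -[i :: p'.2.2]cat1s perm_sym perm_catCA perm_cat2l perm_sym.
exact: pe.
Qed.

Lemma Om_perm q w u : Om q w u != 0 -> perm_eq w u.
Proof.
elim: u w => [|a u IH] w /=; first by case: w => //=; rewrite eqxx.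
by case/ev_neq0 => p /skew_deriv_perm pe /IH; rewrite -(perm_cons a); apply: perm_trans.
Qed.

Lemma Om_nil q u : Om q [::] u = (u == [::])%:R.
Proof. by case: u => //= a u; rewrite ev_nil. Qed.

Lemma Om_letter q i u : Om q [:: i] u = (u == [:: i])%:R.
Proof.
case: u => [|a u] //=; rewrite cats0.
case: (i =P a) => [->|ne]; first by rewrite ev1 mul1r Om_nil eqseq_cons eqxx.
by rewrite ev_nil eqseq_cons eq_sym; case: eqP ne.
Qed.

(* [Om q w _] only involves rearrangements of [w], on which [Q] is constant. *)
Lemma Om_swap q (Q : seq 'I_n -> k) w u :
  (forall w1 w2, perm_eq w1 w2 -> Q w1 = Q w2) -> Q w * Om q w u = Q u * Om q w u.
Proof.
by move=> hQ; case: (eqVneq (Om q w u) 0) => [->|/Om_perm/hQ ->]; rewrite ?mulr0.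
Qed.

Lemma ev_skew_deriv_cat q a w w' phi :
  ev (skew_deriv q a (w ++ w')) phi =
  ev (skew_deriv q a w) (fun y => phi (y ++ w')) +
  (\prod_(l <- w) q l a) * ev (skew_deriv q a w') (fun z => phi (w ++ z)).
Proof.
elim: w phi => [|i w IH] phi; first by rewrite ev_nil big_nil mul1r add0r.
by rewrite cat_cons !ev_skew_deriv_cons IH big_cons mulrDr !mulrA addrA.
Qed.

(** The skew Leibniz rule of [d_a], iterated over the letters of [u], which is unshuffled for the
    transposed braiding matrix. It makes the kernel of the symmetrizer an ideal. *)
Lemma Om_cat q w w' u :
  Om q (w ++ w') u =
  ev (unshuffle (fun i j => q j i) u) (fun b => Om q w b.1 * Om q w' b.2).
Proof.
elim: u w w' => [|a u IH] w w'.
  by rewrite /= ev1 mul1r -natrM mulnb; case: w; case: w'.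
rewrite ev_unshuffle_cons /= ev_skew_deriv_cat; congr (_ + _).
  rewrite (eq_ev _ (fun y => IH y w')) ev_exchange.
  by apply: eq_ev => b; rewrite evZr.
rewrite (eq_ev _ (IH w)) ev_exchange -evZl; apply: eq_ev => b /=.
rewrite evZl mulrA mulrA; congr (_ * _).
(* [Om q w b.1] vanishes unless [b.1] rearranges [w], so the scalar may be taken over either
   word. *)
apply: (@Om_swap q (fun w => \prod_(l <- w) q l a)) => w1 w2; exact: perm_big.
Qed.

(** An instance of coassociativity: [d_a] is the contraction of the left leg of the coproduct with
    [x_a]. *)
Lemma ev_skew_deriv_unshuffle q a w phi :
  ev (skew_deriv q a w) (fun w' => ev (unshuffle q w') phi) =
  ev (unshuffle q w) (fun b => ev (skew_deriv q a b.1) (fun y => phi (y, b.2))).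
Proof.
elim: w phi => [|i w IH] phi; first by rewrite ev_nil ev1 /= ev_nil mulr0.
rewrite ev_skew_deriv_cons ev_unshuffle_cons.
under [X in _ = X + _]eq_ev do rewrite ev_skew_deriv_cons.
rewrite evD evZl evZl -addrA; congr (_ + _).
  by congr (_ * _); apply: eq_ev => -[].
rewrite (eq_ev _ (fun w' => ev_unshuffle_cons q i w' phi)) evD mulrDr.
rewrite (IH (fun b => phi (i :: b.1, b.2))); congr (_ + _).
rewrite (IH (fun b => (\prod_(l <- b.1) q i l) * phi (b.1, i :: b.2))) -evZl.
(* When [i] goes right, it passes [a] as well as the letters that remain on the left, hence the
   factor [q i a]. *)
apply: eq_ev => -[y z] /=; rewrite -!evZl; apply: eq_ev_in => p /skew_deriv_perm pe.
by rewrite (perm_big _ pe) big_cons mulrA.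
Qed.

Lemma Om_unshuffle_nil q w (phi : seq 'I_n -> k) :
  ev (unshuffle q w) (fun b => (b.1 == [::])%:R * phi b.2) = phi w.
Proof.
elim: w phi => [|i w IH] phi; first by rewrite ev1 /= !mul1r.
rewrite ev_unshuffle_cons /= evZl mul0r add0r -[RHS](IH (fun w => phi (i :: w))).
apply: eq_ev => -[[|j y] z] /=; first by rewrite big_nil mul1r.
by rewrite !mul0r mulr0.
Qed.

(** Dual to [Om_cat]: since [d_a] acts on the left tensor factor only, [u] is stripped letter by
    letter. *)
Lemma ev_unshuffle_Om q w u v :
  ev (unshuffle q w) (fun b => Om q b.1 u * Om q b.2 v) = Om q w (u ++ v).
Proof.
elim: u w => [|a u IH] w; first exact: (Om_unshuffle_nil q w (fun z => Om q z v)).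
rewrite /= -(eq_ev _ IH) ev_skew_deriv_unshuffle.
by apply: eq_ev => b /=; rewrite evZr.
Qed.

End FreeAlgebra.

(** * Sums over permutations and over subsets turned into recursions *)

Lemma enum_ord0 : enum 'I_0 = [::].
Proof. by apply/size0nil; rewrite size_enum_ord. Qed.

Section Enumerations.
Variables (k : fieldType) (n : nat).
Implicit Types (q : 'I_n -> 'I_n -> k).

(** Words are functions on ['I_m] here, so that deleting position [j] is composition with
    [lift j]. *)
Lemma ev_skew_deriv_ord q a m (w : 'I_m.+1 -> 'I_n) phi :
  ev (skew_deriv q a [seq w j | j <- enum 'I_m.+1]) phi =
  \sum_(j < m.+1) (w j == a)%:R * (\prod_(l < m.+1 | (l < j)%N) q (w l) a) *
     phi [seq w (lift j l) | l <- enum 'I_m].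
Proof.
elim: m w phi => [|m IH] w phi.
  rewrite big_ord1 enum_ordSl /= ev_skew_deriv_cons big_pred0 // mulr1.
  by rewrite enum_ord0 /= ev_nil mulr0 addr0.
rewrite enum_ordSl /= ev_skew_deriv_cons big_ord_recl big_pred0 // mulr1.
congr (_ + _); first by rewrite -map_comp.
rewrite -map_comp (IH (w \o lift ord0)) mulr_sumr.
apply: eq_bigr => j _ /=.
rewrite [in RHS]big_mkcond big_ord_recl -big_mkcond /= !mulrA [_ * (_ == _)%:R]mulrC.
congr (_ * _ * phi _).
rewrite enum_ordSl /= -map_comp; congr (_ :: _).
  by congr (w _); apply: val_inj.
by apply: eq_map => l /=; congr (w _); apply: val_inj; rewrite /= bumpS.
Qed.

(** A permutation taking [j] to the front is determined by the bijection it induces between the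
    remaining positions. *)
Lemma sum_lift_perm m (j : 'I_m.+1) (P : pred 'S_m.+1) (F : 'S_m.+1 -> k) :
  \sum_(s | P s && ((s^-1)%g ord0 == j)) F s =
  \sum_(t | P (lift_perm j ord0 t)) F (lift_perm j ord0 t).
Proof.
have lift_inj' : injective (lift_perm j ord0 : 'S_m -> _).
  move=> t t' /permP e; apply/permP => l; apply: (lift_inj (h := ord0)).
  by have := e (lift j l); rewrite !lift_perm_lift.
transitivity (\sum_(s in lift_perm j ord0 @: [set: 'S_m]) if P s then F s else 0);
  last first.
  rewrite big_imset /= => [|t t' _ _]; last exact: lift_inj'.
  by rewrite [RHS]big_mkcond; apply: eq_bigl => t; rewrite inE.
rewrite -big_mkcondr; apply: eq_bigl => s; rewrite andbC; congr (_ && _).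
apply/eqP/imsetP => [s0|[t _ ->]]; last by rewrite lift_permV lift_perm_id.
have h_lift l : {l' | lift ord0 l' = s (lift j l)}.
  case: (unliftP ord0 (s (lift j l))) => [l' ->|e]; first by exists l'.
  by have /eqP[] := neq_lift j l; rewrite -[LHS]s0 -e permK.
have h_inj : injective (fun l => sval (h_lift l)).
  move=> l l' e; apply: (@lift_inj _ j); apply: (@perm_inj _ s).
  by rewrite -(svalP (h_lift l)) e (svalP (h_lift l')).
exists (perm h_inj) => //; apply/permP => l; case: (unliftP j l) => [l'|] ->.
  by rewrite lift_perm_lift permE (svalP (h_lift l')).
by rewrite lift_perm_id -s0 permKV.
Qed.

(** [Omega] with the length made a parameter, for an induction that the dependent type ['S_(size w)]
    would obstruct. *)
Definition Omega_ord q m (w : 'I_m -> 'I_n) (u : seq 'I_n) : k :=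
  \sum_(s : 'S_m | [seq w ((s^-1)%g j) | j <- enum 'I_m] == u)
    \prod_(a < m) \prod_(b < m | (a < b)%N && (s b < s a)%N) q (w a) (w b).

(** A permutation taking [j] to the front is that move followed by a permutation of the rest, and
    inversions add up; the move contributes the coefficient in [d_a]. *)
Lemma Omega_ord_Om q m (w : 'I_m -> 'I_n) u :
  Omega_ord q w u = Om q [seq w j | j <- enum 'I_m] u.
Proof.
elim: u m w => [|a u IH] [|m] w.
- rewrite /Omega_ord.
  rewrite enum_ord0 /= (big_pred1 1%g) ?big_ord0 ?eqxx // => s.
  by rewrite !inE; apply/esym/eqP/permP => -[].
- rewrite /Omega_ord big_pred0 /=; first by rewrite enum_ordSl.
  by move=> s; rewrite enum_ordSl.
- rewrite /Omega_ord big_pred0 /=.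
    by rewrite enum_ord0 ev_nil.
  by move=> s; rewrite enum_ord0.
rewrite /= ev_skew_deriv_ord /Omega_ord.
(* The letter at position [s^-1 ord0] comes first in the rearranged word, so the sum is split by
   this position. *)
rewrite (partition_big (fun s : 'S_m.+1 => (s^-1)%g ord0) xpredT) //=.
apply: eq_bigr => j _; rewrite -IH /Omega_ord mulr_sumr.
rewrite sum_lift_perm big_mkcond [RHS]big_mkcond /=; apply: eq_bigr => t _.
rewrite lift_permV enum_ordSl /= lift_perm_id eqseq_cons.
rewrite -map_comp /=.
under eq_map => l do rewrite /= lift_perm_lift.
case: (w j =P a) => [wj|_] /=; last by rewrite !mul0r if_same.
(* Nothing lands before [ord0], so no inversion has [j] as its left member. *)
case: eqP => // _; rewrite mul1r (bigD1_ord j) //= big_pred0 ?mul1r; last first.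
  by move=> b; rewrite lift_perm_id ltn0 andbF.
rewrite [X in _ = X * _]big_mkcond [X in _ = X * _](bigD1_ord j) //= ltnn mul1r.
rewrite -big_split /=.
(* Any other position is inverted with [j] exactly when it precedes [j]; the remaining inversions
   are those of [t]. *)
apply: eq_bigr => l _; rewrite big_mkcond [LHS](bigD1_ord j) //= -big_mkcond /=.
rewrite lift_perm_id lift_perm_lift /= wj andbT; congr (_ * _).
rewrite [LHS]big_mkcond [RHS]big_mkcond; apply: eq_bigr => b _.
rewrite lift_perm_lift /=; congr (if _ then _ else _).
by rewrite ltnNge leq_bump2 -ltnNge.
Qed.

Definition consset m (b : bool) (X : {set 'I_m}) : {set 'I_m.+1} :=
  [set j | if unlift ord0 j is Some l then l \in X else b].

Lemma in_consset0 m b (X : {set 'I_m}) : (ord0 \in consset b X) = b.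
Proof. by rewrite inE unlift_none. Qed.

Lemma in_consset_lift m b (X : {set 'I_m}) l : (lift ord0 l \in consset b X) = (l \in X).
Proof. by rewrite inE liftK. Qed.

Lemma sum_consset m (F : {set 'I_m.+1} -> k) :
  \sum_X F X = \sum_(X : {set 'I_m}) F (consset true X) +
               \sum_(X : {set 'I_m}) F (consset false X).
Proof.
pose h (b : bool * {set 'I_m}) := consset b.1 b.2.
rewrite (reindex h) /=.
  rewrite -(pair_bigA _ (fun b X => F (consset b X))) /=.
  by rewrite (bigD1 true) //= (big_pred1 false) // => -[].
exists (fun X : {set 'I_m.+1} => (ord0 \in X, [set l : 'I_m | lift ord0 l \in X])).
  case=> b X _; rewrite /h /= in_consset0; congr (_, _).
  by apply/setP => l; rewrite inE in_consset_lift.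
move=> X _; apply/setP => j; rewrite /h /=; case: (unliftP ord0 j) => [l|] ->.
  by rewrite in_consset_lift inE.
by rewrite in_consset0.
Qed.

Definition coefD_ord q m (w : 'I_m -> 'I_n) (X : {set 'I_m}) : k :=
  \prod_(j < m | j \notin X) \prod_(l < m | (j < l)%N && (l \in X)) q (w j) (w l).

Lemma coefD_ord_cons q m (w : 'I_m.+1 -> 'I_n) b (X : {set 'I_m}) :
  coefD_ord q w (consset b X) =
  (if b then 1 else \prod_(l < m | l \in X) q (w ord0) (w (lift ord0 l))) *
  coefD_ord q (w \o lift ord0) X.
Proof.
rewrite {1}/coefD_ord big_mkcond big_ord_recl in_consset0 -big_mkcond /=.
congr (_ * _).
  case: b => //=; rewrite big_mkcond big_ord_recl /= mul1r -big_mkcond /=.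
  by apply: eq_bigl => l; rewrite in_consset_lift.
apply: eq_big => [l|l _]; first by rewrite in_consset_lift.
rewrite big_mkcond big_ord_recl /= mul1r -big_mkcond /=.
by apply: eq_bigl => l'; rewrite in_consset_lift.
Qed.

(** [X] is the set of positions sent to the left factor. Whether it contains [ord0] decides between
    the two summands of the recursion. *)
Lemma sum_subsets_unshuffle q m (w : 'I_m -> 'I_n) phi :
  \sum_(X : {set 'I_m}) coefD_ord q w X *
    phi (mask [seq j \in X | j <- enum 'I_m] [seq w j | j <- enum 'I_m],
         mask [seq j \notin X | j <- enum 'I_m] [seq w j | j <- enum 'I_m]) =
  ev (unshuffle q [seq w j | j <- enum 'I_m]) phi.
Proof.
elim: m w phi => [|m IH] w phi.
  rewrite enum_ord0 ev1 (big_pred1 set0); first by rewrite /coefD_ord big_ord0.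
  by move=> X; apply/esym/eqP/setP => -[].
rewrite sum_consset enum_ordSl /= ev_unshuffle_cons -map_comp -!(IH (w \o lift ord0)).
congr (_ + _); apply: eq_bigr => X _; rewrite coefD_ord_cons in_consset0 /=.
  rewrite mul1r -!(map_comp _ (lift ord0)).
  under [X in mask X _]eq_map => l do rewrite /= in_consset_lift.
  by under [X in (_, mask X _)]eq_map => l do rewrite /= in_consset_lift.
rewrite -!(map_comp _ (lift ord0)) [X in X * _]mulrC -mulrA; congr (_ * (_ * phi _)).
  rewrite -map_mask -filter_mask big_map big_filter big_enum_cond.
  by apply: eq_bigl => l.
congr (_, _ :: _).
  under [X in mask X _]eq_map => l do rewrite /= in_consset_lift.
  by [].
by under [X in mask X _]eq_map => l do rewrite /= in_consset_lift.
Qed.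

End Enumerations.

(** * Coordinates on the bosonization *)

Section Coefficients.
Variables (k : fieldType) (G : zmodType) (n : nat).
Variables (g : 'I_n -> G) (chi : 'I_n -> G -> k).
Local Notation q := (qb g chi).
Local Notation basis := (basisA G n).
Local Notation FS := (FS k G n).
Local Notation FS2 := (FS2 k G n).
Implicit Types (F : linmap k G n) (f : FS) (b : basis) (x y : G * word n).

(** The coordinate functionals: by [zeroAE] their common kernel is exactly the set of formal sums
    representing zero. *)
Definition coef b x : k := (b.2 == x.1)%:R * Om q b.1 x.2.

Lemma OmegaE w u : Omega g chi w u = Om q w u.
Proof.
have -> : Omega g chi w u = Omega_ord q (tnth (in_tuple w)) u by [].
by rewrite Omega_ord_Om map_tnth_enum.
Qed.

Lemma zeroAE f : zeroA g chi f <-> forall x, ev f (coef^~ x) = 0.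
Proof.
have e gam u : \sum_(p <- f | p.2.2 == gam) p.1 * Omega g chi p.2.1 u =
               ev f (coef^~ (gam, u)).
  rewrite big_mkcond; apply: eq_bigr => p _; rewrite OmegaE /coef /=.
  by case: eqP; rewrite ?mul1r // mul0r mulr0.
by split=> [z [gam u]|z gam u]; rewrite ?e // -e.
Qed.

Lemma eqAE f f' : eqA g chi f f' <-> forall x, ev f (coef^~ x) = ev f' (coef^~ x).
Proof.
by split=> [/zeroAE h x|h]; [have := h x|apply/zeroAE => x];
  rewrite ev_cat ev_opp; [move/eqP; rewrite subr_eq0 => /eqP|rewrite h subrr].
Qed.

Lemma eqAAE (f f' : FS2) : eqAA g chi f f' <-> forall x y,
  ev f (fun c => coef c.1 x * coef c.2 y) = ev f' (fun c => coef c.1 x * coef c.2 y).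
Proof.
have e (h : FS2) gam del u v :
  \sum_(p <- h | (p.2.1.2 == gam) && (p.2.2.2 == del))
     p.1 * Omega g chi p.2.1.1 u * Omega g chi p.2.2.1 v =
  ev h (fun c => coef c.1 (gam, u) * coef c.2 (del, v)).
  rewrite big_mkcond; apply: eq_bigr => p _; rewrite !OmegaE /coef /=.
  by do 2!case: eqP => _; rewrite /= ?mul1r ?mul0r ?mulr0 ?mul0r ?mulr0 ?mulrA.
split=> [h [gam u] [del v]|h gam del u v]; last first.
  by rewrite e ev_cat ev_opp h subrr.
by have := h gam del u v; rewrite e ev_cat ev_opp => /eqP; rewrite subr_eq0 => /eqP.
Qed.

Lemma ev_flatten T (ss : seq (seq (k * T))) phi :
  ev (flatten ss) phi = \sum_(s <- ss) ev s phi.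
Proof.
by elim: ss => [|s ss IH]; rewrite ?big_nil ?ev_nil //= ev_cat IH big_cons.
Qed.

Lemma ev_scale S T (h : S -> T) c (f : seq (k * S)) phi :
  ev [seq (c * p.1, h p.2) | p <- f] phi = c * ev f (phi \o h).
Proof. by rewrite ev_map /ev mulr_sumr; apply: eq_bigr => p _; rewrite mulrA. Qed.

Lemma ev_applyL F f phi : ev (applyL F f) phi = ev f (fun b => ev (F b) phi).
Proof.
by rewrite ev_flatten big_map; apply: eq_bigr => p _; rewrite (ev_scale id).
Qed.

Lemma ev_DeltaA f phi :
  ev (DeltaA g chi f) phi = ev f (fun b => ev (DeltaB g chi b) phi).
Proof.
by rewrite ev_flatten big_map; apply: eq_bigr => p _; rewrite (ev_scale id).
Qed.

Lemma ev_applyL2 F (f : FS2) phi : ev (applyL2 F f) phi =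
  ev f (fun e => ev (F e.1) (fun c => ev (F e.2) (fun d => phi (c, d)))).
Proof.
rewrite ev_flatten big_map; apply: eq_bigr => p _.
rewrite /ev big_allpairs_dep mulr_sumr; apply: eq_bigr => c _ /=.
by rewrite !mulr_sumr; apply: eq_bigr => d _ /=; rewrite !mulrA.
Qed.

Lemma ev_mulA f f' phi : ev (Defs.mulA chi f f') phi =
  ev f (fun b => ev f' (fun b' => ev (mulB chi b b') phi)).
Proof.
rewrite /Defs.mulA ev_flatten big_allpairs_dep; apply: eq_bigr => p _.
rewrite /ev mulr_sumr; apply: eq_bigr => p' _.
by rewrite big_map mulrA mulr_sumr; apply: eq_bigr => r _; rewrite mulrA.
Qed.

Lemma ev_mulB b b' phi :
  ev (mulB chi b b') phi = chiw chi b'.1 b.2 * phi (b.1 ++ b'.1, b.2 + b'.2).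
Proof. by rewrite /mulB ev1. Qed.

Lemma chiw_perm w w' a : perm_eq w w' -> chiw chi w a = chiw chi w' a.
Proof. exact: perm_big. Qed.

Lemma chiw0 w : (forall i, chi i 0 = 1) -> chiw chi w 0 = 1.
Proof. by move=> chi_0; rewrite /chiw big1. Qed.

Definition weight (w : word n) : G := \sum_(i <- w) g i.

Lemma weight_perm w w' : perm_eq w w' -> weight w = weight w'.
Proof. exact: perm_big. Qed.

Lemma ev_DeltaB b phi : ev (DeltaB g chi b) phi =
  ev (unshuffle q b.1)
     (fun c => phi ((c.1, weight c.2 + b.2), (c.2, b.2))).
Proof.
case: b => w a /=; set Phi' := fun c => _.
have := sum_subsets_unshuffle q (tnth (in_tuple w)) Phi'.
rewrite map_tnth_enum => <-; rewrite /DeltaB ev_map big_enum /=.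
apply: eq_bigr => X _; congr (_ * _); rewrite /Phi' /=.
have -> : [seq ~~ i | i <- bitsS X] = [seq j \notin X | j <- enum 'I_(size w)].
  by rewrite /bitsS -map_comp.
congr (phi ((_, _ + _), _)); rewrite /gsum /weight.
rewrite -[X in mask _ X]/(tval (in_tuple w)) -(map_tnth_enum (in_tuple w)).
by rewrite -map_mask -filter_mask big_map big_filter big_enum_cond.
Qed.

(** These functionals are the ones that descend to [B(V) # kG]. *)
Definition respects (phi : basis -> k) :=
  forall f, zeroA g chi f -> ev f phi = 0.

Lemma respects_eqA phi f f' : respects phi -> eqA g chi f f' -> ev f phi = ev f' phi.
Proof.
by move=> r /r; rewrite ev_cat ev_opp => /eqP; rewrite subr_eq0 => /eqP.
Qed.

(** A finite combination of coordinates descends; what matters is that [L], [c] and [h] do not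
    depend on [b]. *)
Lemma respects_span T (L : seq (k * T)) (c : T -> k) (h : T -> G * word n) phi :
  (forall b, phi b = ev L (fun t => c t * coef b (h t))) -> respects phi.
Proof.
move=> e f /zeroAE z; rewrite (eq_ev _ e) ev_exchange {1}/ev big1 // => p _.
by rewrite evZl z !mulr0.
Qed.

(** [Om_cat] expands the product. The twist by [b.2] is constant on the support, where
    [b.2 = x.1 - b'.2]. *)
Lemma respects_mulBr b' x : respects (fun b => ev (mulB chi b b') (coef^~ x)).
Proof.
apply: (@respects_span _ (unshuffle (fun i j => q j i) x.2)
  (fun c => chiw chi b'.1 (x.1 - b'.2) * Om q b'.1 c.2) (fun c => (x.1 - b'.2, c.1))).
move=> b; rewrite ev_mulB /coef Om_cat /= -!evZl; apply: eq_ev => c /=.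
have -> : (b.2 + b'.2 == x.1) = (b.2 == x.1 - b'.2).
  by rewrite [LHS]eq_sym -[LHS]subr_eq eq_sym.
case: eqP => [->|_]; last by rewrite !(mul0r, mulr0).
by rewrite !mul1r mulrAC mulrA.
Qed.

(** Here the twist involves the varying word [b'.1]; it is moved to its rearrangement [c.2], which
    does not depend on [b']. *)
Lemma respects_mulBl b x : respects (fun b' => ev (mulB chi b b') (coef^~ x)).
Proof.
apply: (@respects_span _ (unshuffle (fun i j => q j i) x.2)
  (fun c => chiw chi c.2 b.2 * Om q b.1 c.1) (fun c => (x.1 - b.2, c.2))).
move=> b'; rewrite ev_mulB /coef Om_cat /= -!evZl; apply: eq_ev => c /=.
have e := @Om_swap _ _ q (chiw chi ^~ b.2) b'.1 c.2.
have -> : (b.2 + b'.2 == x.1) = (b'.2 == x.1 - b.2).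
  by rewrite [LHS]eq_sym addrC -[LHS]subr_eq eq_sym.
case: eqP => _; last by rewrite !(mul0r, mulr0).
rewrite !mul1r mulrCA {}e => [|w1 w2]; last exact: chiw_perm.
by rewrite mulrCA mulrA.
Qed.

Lemma mulA_eqA f1 f1' f2 f2' : eqA g chi f1 f1' -> eqA g chi f2 f2' ->
  eqA g chi (Defs.mulA chi f1 f2) (Defs.mulA chi f1' f2').
Proof.
move=> e1 e2; apply/eqAE => x; rewrite !ev_mulA.
under eq_ev => b do rewrite (respects_eqA (respects_mulBl b x) e2).
rewrite ev_exchange [RHS]ev_exchange; apply: eq_ev => b'.
exact: respects_eqA (respects_mulBr b' x) e1.
Qed.

Lemma ev_DeltaB_coef b x y : ev (DeltaB g chi b) (fun c => coef c.1 x * coef c.2 y) =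
  (x.1 == weight y.2 + y.1)%:R * coef b (y.1, x.2 ++ y.2).
Proof.
rewrite ev_DeltaB /coef /= -ev_unshuffle_Om -!evZl; apply: eq_ev => c /=.
(* The degree of the right factor enters the group component of the left one; it can be computed
   from [y.2], a rearrangement of [c.2]. *)
case: (eqVneq (Om q c.2 y.2) 0) => [->|/Om_perm/weight_perm ->].
  by rewrite !mulr0.
case: (b.2 =P y.1) => [->|_]; last by rewrite !(mul0r, mulr0).
by rewrite eq_sym !mul1r mulrA.
Qed.

Lemma ev_DeltaA_coef f x y : ev (DeltaA g chi f) (fun c => coef c.1 x * coef c.2 y) =
  (x.1 == weight y.2 + y.1)%:R * ev f (coef^~ (y.1, x.2 ++ y.2)).
Proof.
by rewrite ev_DeltaA -evZl; apply: eq_ev => b; rewrite ev_DeltaB_coef.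
Qed.

Lemma ev_applyL2_coef F (d : FS2) x y :
  ev (applyL2 F d) (fun c => coef c.1 x * coef c.2 y) =
  ev d (fun c => ev (F c.1) (coef^~ x) * ev (F c.2) (coef^~ y)).
Proof.
rewrite ev_applyL2; apply: eq_ev => c /=; rewrite -evZr; apply: eq_ev => e.
by rewrite evZl.
Qed.

Lemma well_definedE F :
  well_defined g chi F <-> forall x, respects (fun b => ev (F b) (coef^~ x)).
Proof.
split=> [wd x f /wd /zeroAE /(_ x)|r f z]; first by rewrite ev_applyL.
by apply/zeroAE => x; rewrite ev_applyL; apply: r.
Qed.

End Coefficients.

(** * Grouplike elements in coordinates *)

Section Grouplike.
Variables (k : fieldType) (G : zmodType) (n : nat).
Variables (g : 'I_n -> G) (chi : 'I_n -> G -> k).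
Local Notation q := (qb g chi).
Local Notation basis := (basisA G n).
Local Notation FS := (FS k G n).
Local Notation FS2 := (FS2 k G n).
Local Notation coef := (coef g chi).
Implicit Types (F : linmap k G n) (f : FS) (b : basis) (x y : G * word n) (a : G).

Lemma coef_nil a x : coef ([::], a) x = (a == x.1)%:R * (x.2 == [::])%:R.
Proof. by rewrite /coef Om_nil. Qed.

Lemma coef_letter i a x : coef ([:: i], a) x = (a == x.1)%:R * (x.2 == [:: i])%:R.
Proof. by rewrite /coef Om_letter. Qed.

(** The equation [Delta f = f (x) f] in coordinates. It also holds for zero, which [grouplike_coef]
    excludes separately. *)
Definition grouplike f := forall x y,
  (x.1 == weight g y.2 + y.1)%:R * ev f (coef^~ (y.1, x.2 ++ y.2)) =
  ev f (coef^~ x) * ev f (coef^~ y).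

Lemma coef_bounded f :
  exists N, forall x, (N < size x.2)%N -> ev f (coef^~ x) = 0.
Proof.
exists (\max_(p <- f) size p.2.1)%N => x big; apply/eqP/negPn/negP.
case/ev_neq0 => p pf; rewrite /coef mulf_eq0 negb_or => /andP[_ /Om_perm pe].
by apply/negP: big; rewrite -leqNgt -(perm_size pe); apply: (leq_bigmax_seq _ pf).
Qed.

(* Squaring the coefficient at a nonempty word [u] yields the one at [u ++ u], so
   by boundedness only the empty word can occur. *)
Lemma grouplike_nil f x : grouplike f -> x.2 != [::] -> ev f (coef^~ x) = 0.
Proof.
move=> gl; have [N bound] := coef_bounded f.
(* Descending induction on the length of the word: [m] measures how far it may lie below the
   bound. *)
have main m : forall x, (N < size x.2 + m)%N -> x.2 != [::] -> ev f (coef^~ x) = 0.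
  elim: m => [|m IH] y lt ne; first by apply: bound; rewrite addn0 in lt.
  apply/eqP; have /esym := gl y y; rewrite (IH (y.1, y.2 ++ y.2)) /=; first last.
  - by case: (y.2) ne.
  - rewrite size_cat; move: ne lt; case: (y.2) => //= i u _.
    by rewrite -addnA => /leq_trans -> //; rewrite leq_add2l addnC -addn1 leq_add2l.
  by rewrite mulr0 => /eqP; rewrite mulf_eq0 orbb.
by apply: (main N.+1); rewrite addnS ltnS leq_addl.
Qed.

(** On empty words the equation reads [[a = a'] c(a') = c(a) c(a')], so a nonzero [c(a)] equals 1
    and excludes all others. *)
Lemma grouplike_coef f : grouplike f -> (exists x, ev f (coef^~ x) != 0) ->
  exists a, forall x, ev f (coef^~ x) = coef ([::], a) x.
Proof.
move=> gl [[a u] nz].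
have u0 : u = [::].
  by apply/eqP/negPn/negP => /(@grouplike_nil _ (a, u) gl) e; rewrite e eqxx in nz.
exists a => -[a' v]; rewrite coef_nil /=.
have [->|v0] := eqVneq v [::]; last by rewrite mulr0; apply: grouplike_nil.
rewrite u0 in nz; rewrite mulr1.
have := gl (a, [::]) (a', [::]); rewrite /weight big_nil add0r /=.
have [<-|_] := eqVneq a a'; first by rewrite mul1r -{1}[ev _ _]mulr1 => /(mulfI nz) <-.
by rewrite mul0r => /esym/eqP; rewrite mulf_eq0 (negbTE nz) => /eqP.
Qed.

Lemma ev_DeltaB_nil a (phi : basis * basis -> k) :
  ev (DeltaB g chi ([::], a)) phi = phi (([::], a), ([::], a)).
Proof. by rewrite ev_DeltaB ev1 /weight big_nil add0r mul1r. Qed.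

Lemma ev_DeltaB_letter i (phi : basis * basis -> k) :
  ev (DeltaB g chi ([:: i], 0)) phi =
  phi (([:: i], 0), ([::], 0)) + phi (([::], g i), ([:: i], 0)).
Proof.
by rewrite ev_DeltaB /= ev_cons ev1 /weight !big_nil big_seq1 !addr0 !mulr1 !mul1r.
Qed.

(** One leg is treated at a time: contracting the other leg leaves an equality in [B(V) # kG], to
    which a descending functional applies. *)
Lemma respects_tensor (d d' : FS2) phi psi :
  respects g chi phi -> respects g chi psi ->
  (forall x y, ev d (fun c => coef c.1 x * coef c.2 y) =
               ev d' (fun c => coef c.1 x * coef c.2 y)) ->
  ev d (fun c => phi c.1 * psi c.2) = ev d' (fun c => phi c.1 * psi c.2).
Proof.
move=> rphi rpsi e.
have left y : ev d (fun c => phi c.1 * coef c.2 y) =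
              ev d' (fun c => phi c.1 * coef c.2 y).
  pose f (d : FS2) := [seq (p.1 * coef p.2.2 y, p.2.1) | p <- d].
  have fE d0 theta : ev (f d0) theta = ev d0 (fun c => theta c.1 * coef c.2 y).
    by rewrite ev_map; apply: eq_bigr => p _ /=; rewrite mulrAC mulrA.
  by rewrite -!fE; apply: (respects_eqA rphi); apply/eqAE => x; rewrite !fE.
pose f (d : FS2) := [seq (p.1 * phi p.2.1, p.2.2) | p <- d].
have fE d0 theta : ev (f d0) theta = ev d0 (fun c => phi c.1 * theta c.2).
  by rewrite ev_map; apply: eq_bigr => p _ /=; rewrite mulrA.
by rewrite -!fE; apply: (respects_eqA rpsi); apply/eqAE => y; rewrite !fE.
Qed.

End Grouplike.

(** * Images of grouplikes and of generators under an automorphism *)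

Section Automorphism.
Variables (k : fieldType) (G : zmodType) (n : nat).
Variables (g : 'I_n -> G) (chi : 'I_n -> G -> k).
Local Notation coef := (coef g chi).
Variables F F' : linmap k G n.
Hypothesis wdF : well_defined g chi F.
Hypothesis wdF' : well_defined g chi F'.
Hypothesis FK : forall b, eqA g chi (applyL F' (F b)) (Defs.basis_of k b).
Hypothesis F'K : forall b, eqA g chi (applyL F (F' b)) (Defs.basis_of k b).
Hypothesis F_mul :
  forall b b', eqA g chi (applyL F (mulB chi b b')) (Defs.mulA chi (F b) (F b')).
Hypothesis F_Delta :
  forall b, eqAA g chi (DeltaA g chi (F b)) (applyL2 F (DeltaB g chi b)).
Implicit Types (b : basisA G n) (x y : G * word n) (a h : G).

Lemma F_Delta_coef b x y :
  (x.1 == weight g y.2 + y.1)%:R * ev (F b) (coef^~ (y.1, x.2 ++ y.2)) =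
  ev (DeltaB g chi b) (fun c => ev (F c.1) (coef^~ x) * ev (F c.2) (coef^~ y)).
Proof. by rewrite -ev_DeltaA_coef -ev_applyL2_coef; have /eqAAE := F_Delta b. Qed.

Lemma coef_FK b x : ev (F b) (fun b' => ev (F' b') (coef^~ x)) = coef b x.
Proof. by have /eqAE/(_ x) := FK b; rewrite ev_applyL ev1 mul1r. Qed.

Lemma coef_F'K b x : ev (F' b) (fun b' => ev (F b') (coef^~ x)) = coef b x.
Proof. by have /eqAE/(_ x) := F'K b; rewrite ev_applyL ev1 mul1r. Qed.

(** [F'] descends to the quotient and recovers [b], so it cannot start from zero. *)
Lemma F_neq0 b x : coef b x != 0 -> exists y, ev (F b) (coef^~ y) != 0.
Proof.
move=> nz; apply: NNPP => none; case/eqP: nz; rewrite -coef_FK.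
have /well_definedE/(_ x) := wdF'; apply; apply/zeroAE => y.
by apply/eqP/negPn/negP => nz; apply: none; exists y.
Qed.

Lemma F'_neq0 b x : coef b x != 0 -> exists y, ev (F' b) (coef^~ y) != 0.
Proof.
move=> nz; apply: NNPP => none; case/eqP: nz; rewrite -coef_F'K.
have /well_definedE/(_ x) := wdF; apply; apply/zeroAE => y.
by apply/eqP/negPn/negP => nz; apply: none; exists y.
Qed.

Lemma grouplike_F a : grouplike g chi (F ([::], a)).
Proof. by move=> x y; rewrite F_Delta_coef ev_DeltaB_nil. Qed.

(* The inverse is comultiplicative because [F (x) F] is injective. *)
Lemma grouplike_F' a : grouplike g chi (F' ([::], a)).
Proof.
move=> x y; rewrite -ev_DeltaA_coef; set f := F' _.
pose ff := [seq (p.1 * p'.1, (p.2, p'.2)) | p <- f, p' <- f].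
have ffE phi psi : ev ff (fun c => phi c.1 * psi c.2) = ev f phi * ev f psi.
  rewrite /ev big_allpairs_dep mulr_suml; apply: eq_bigr => p _.
  by rewrite mulr_sumr; apply: eq_bigr => p' _ /=; rewrite mulrACA.
rewrite -ffE.
(* Every coordinate of [d] factors through [F (x) F], so it suffices to compare both sides after
   applying that map. *)
have expand d : ev d (fun c => coef c.1 x * coef c.2 y) =
    ev (applyL2 F d) (fun c => ev (F' c.1) (coef^~ x) * ev (F' c.2) (coef^~ y)).
  rewrite ev_applyL2; apply: eq_ev => c /=; rewrite -!coef_FK -evZr.
  by apply: eq_ev => c'; rewrite evZl.
rewrite !expand; apply: (@respects_tensor _ _ _ g chi _ _
  (fun b => ev (F' b) (coef^~ x)) (fun b => ev (F' b) (coef^~ y))).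
- by move/well_definedE: wdF'; apply.
- by move/well_definedE: wdF'; apply.
move=> {expand} {}x {}y; rewrite !ev_applyL2_coef.
rewrite (ffE (fun b => ev (F b) (coef^~ x)) (fun b => ev (F b) (coef^~ y))).
rewrite !coef_F'K ev_DeltaA.
rewrite (@eq_ev _ _ _ _ (fun b => (x.1 == weight g y.2 + y.1)%:R *
  ev (F b) (coef^~ (y.1, x.2 ++ y.2)))); last by move=> b; rewrite F_Delta_coef.
by rewrite evZl coef_F'K -ev_DeltaB_coef ev_DeltaB_nil.
Qed.

Lemma coef_nil_neq0 a : coef ([::], a) (a, [::]) != 0.
Proof. by rewrite coef_nil !eqxx mulr1 oner_eq0. Qed.

Lemma coef_nil_inj a a' :
  (forall x, coef ([::], a) x = coef ([::], a') x) -> a = a'.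
Proof.
move/(_ (a, [::])) => e; have := coef_nil_neq0 a; rewrite e coef_nil /= mulr1.
by have [->|_] := eqVneq a' a; rewrite ?eqxx.
Qed.

(** The group element is selected by a decidable condition, a nonzero coefficient at the empty word,
    so [xchoose] suffices. *)
Lemma grouplike_fun (E : linmap k G n) :
  (forall a, exists a', forall x, ev (E ([::], a)) (coef^~ x) = coef ([::], a') x) ->
  exists psi : G -> G,
    forall a x, ev (E ([::], a)) (coef^~ x) = coef ([::], psi a) x.
Proof.
move=> ex; have ex' a : exists a', ev (E ([::], a)) (coef^~ (a', [::])) != 0.
  by have [a' e] := ex a; exists a'; rewrite e coef_nil_neq0.
exists (fun a => xchoose (ex' a)) => a x; have := xchooseP (ex' a).
have [a' e] := ex a; rewrite !e; set c := xchoose _; rewrite coef_nil /= mulr1.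
by have [->|_] := eqVneq a' c; rewrite ?eqxx.
Qed.

Lemma grouplike_aut : exists psi : G -> G,
  [/\ forall a x, ev (F ([::], a)) (coef^~ x) = coef ([::], psi a) x,
      bijective psi & forall a a', psi (a + a') = psi a + psi a'].
Proof.
have [a|psi psiE] := @grouplike_fun F.
  by apply: grouplike_coef (@grouplike_F a) (F_neq0 (coef_nil_neq0 a)).
have [a|psi' psi'E] := @grouplike_fun F'.
  by apply: grouplike_coef (@grouplike_F' a) (F'_neq0 (coef_nil_neq0 a)).
have FE a : eqA g chi (F ([::], a)) (Defs.basis_of k ([::], psi a)).
  by apply/eqAE => x; rewrite psiE ev1 mul1r.
have F'E a : eqA g chi (F' ([::], a)) (Defs.basis_of k ([::], psi' a)).
  by apply/eqAE => x; rewrite psi'E ev1 mul1r.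
exists psi; split=> //.
- exists psi' => a; apply: coef_nil_inj => x.
    rewrite -[RHS]coef_FK -psi'E.
    have /well_definedE/(_ x)/respects_eqA/(_ (FE a)) -> := wdF'.
    by rewrite ev1 mul1r.
  rewrite -[RHS]coef_F'K -psiE.
  have /well_definedE/(_ x)/respects_eqA/(_ (F'E a)) -> := wdF.
  by rewrite ev1 mul1r.
move=> a a'; apply: coef_nil_inj => x; rewrite -psiE.
have /eqAE/(_ x) := F_mul ([::], a) ([::], a').
rewrite ev_applyL ev_mulB /chiw big_nil mul1r => ->.
have /eqAE -> := mulA_eqA (FE a) (FE a').
by rewrite ev_mulA !ev1 /chiw big_nil !mul1r.
Qed.

Variable psi : G -> G.
Hypothesis psiE : forall a x, ev (F ([::], a)) (coef^~ x) = coef ([::], psi a) x.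
Hypothesis psiD : forall a a', psi (a + a') = psi a + psi a'.

Local Notation skew i := (F ([:: i], 0)).

(** The equation [Delta (F x_i) = F x_i (x) 1 + psi (g i) (x) F x_i] in coordinates. *)
Lemma F_skew_primitive i x y :
  (x.1 == weight g y.2 + y.1)%:R * ev (skew i) (coef^~ (y.1, x.2 ++ y.2)) =
  ev (skew i) (coef^~ x) * coef ([::], 0) y +
  coef ([::], psi (g i)) x * ev (skew i) (coef^~ y).
Proof.
have psi0 : psi 0 = 0 by apply: (addrI (psi 0)); rewrite -psiD !addr0.
by rewrite F_Delta_coef ev_DeltaB_letter /= !psiE psi0.
Qed.

(** Apply [F] to [h x_i = chi_i(h) x_i h] and read both sides at the translate [z] of [x] by
    [psi h]. *)
Lemma F_conj i h x :
  chiw chi x.2 (psi h) * ev (skew i) (coef^~ x) =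
  chi i h * ev (skew i) (coef^~ x).
Proof.
have Fh : eqA g chi (F ([::], h)) (Defs.basis_of k ([::], psi h)).
  by apply/eqAE => z; rewrite psiE ev1 mul1r.
have eqA_refl f : eqA g chi f f by apply/eqAE.
pose z := (psi h + x.1, x.2).
have coefz b : coef (b.1, psi h + b.2) z = coef b x.
  by rewrite /coef /z /= (inj_eq (addrI _)).
have right_mul : ev (F ([:: i], h)) (coef^~ z) = ev (skew i) (coef^~ x).
  have /eqAE/(_ z) := F_mul ([:: i], 0) ([::], h).
  rewrite ev_applyL ev_mulB /chiw big_nil mul1r /= add0r => ->.
  have /eqAE -> := mulA_eqA (eqA_refl (skew i)) Fh.
  rewrite ev_mulA; apply: eq_ev => b.
  by rewrite ev1 mul1r ev_mulB /chiw big_nil mul1r cats0 addrC coefz.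
have /eqAE/(_ z) := F_mul ([::], h) ([:: i], 0).
rewrite ev_applyL ev_mulB /chiw big_seq1 /= addr0 right_mul => ->.
have /eqAE -> := mulA_eqA Fh (eqA_refl (skew i)).
rewrite ev_mulA ev1 mul1r -evZl; apply: eq_ev => b.
rewrite ev_mulB /= coefz /coef !(mulrCA _ (_ == _)%:R).
congr (_ * _); apply/esym/(@Om_swap _ _ _ (chiw chi ^~ (psi h))) => w w'.
exact: chiw_perm.
Qed.

Lemma F_letter_support i x :
  (exists h, chi i h != 1) -> ev (skew i) (coef^~ x) != 0 ->
  exists j, [/\ x = (0, [:: j]), psi (g i) = g j & forall h, chi i h = chi j (psi h)].
Proof.
move=> [h0 nontriv]; case: x => gam [|j [|l u]] nz.
(* At the empty word conjugation acts trivially, which would give [chi i h0 = 1]. *)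
- case/eqP: nontriv; apply: (mulIf nz); rewrite -F_conj /chiw big_nil //.
- have e1 : gam = 0.
    (* With an empty right word only the term [F x_i (x) 1] survives, and it requires [gam = 0]. *)
    have := F_skew_primitive i (gam, [:: j]) (gam, [::]).
    rewrite !coef_nil /weight big_nil add0r eqxx /= mulr0 !mul0r addr0 mul1r mulr1.
    by case: eqP => // _ e; rewrite e mulr0 eqxx in nz.
  exists j; rewrite e1 in nz *; split=> //.
    (* With an empty left word only [psi (g i) (x) F x_i] survives, and it requires
       [psi (g i) = g j]. *)
    have := F_skew_primitive i (g j, [::]) (0, [:: j]).
    rewrite !coef_nil /weight big_seq1 addr0 eqxx /= !mulr0 mulr1 add0r mul1r.
    by case: eqP => // _ e; rewrite e mul0r eqxx in nz.
  by move=> h; apply: (mulIf nz); rewrite -F_conj /chiw big_seq1.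
(* A longer word is cut into two nonempty parts, where both terms on the right vanish. *)
have := F_skew_primitive i (weight g (l :: u) + gam, [:: j]) (gam, l :: u).
by rewrite !coef_nil eqxx /= !mulr0 mul0r addr0 mul1r => e; rewrite e eqxx in nz.
Qed.

End Automorphism.

(** * Monomial maps, and the monomial form of every automorphism *)

Section Monomial.
Variables (k : fieldType) (G : zmodType) (n : nat).
Variables (g : 'I_n -> G) (chi : 'I_n -> G -> k).
Hypothesis chi_0 : forall i, chi i 0 = 1.
Local Notation q := (qb g chi).
Local Notation coef := (coef g chi).
Implicit Types (lam : 'I_n -> k) (sig : {perm 'I_n}) (psi : G -> G).
Implicit Types (b : basisA G n) (x y : G * word n).

Lemma ev_skew_deriv_map sig a w phi :
  (forall i j, q (sig i) (sig j) = q i j) ->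
  ev (skew_deriv q (sig a) (map sig w)) phi =
  ev (skew_deriv q a w) (fun w' => phi (map sig w')).
Proof.
move=> qsig; elim: w phi => [|i w IH] phi; first by rewrite !ev_nil.
by rewrite map_cons !ev_skew_deriv_cons IH qsig (inj_eq perm_inj).
Qed.

Lemma Om_map sig w u : (forall i j, q (sig i) (sig j) = q i j) ->
  Om q (map sig w) (map sig u) = Om q w u.
Proof.
move=> qsig; elim: u w => [|a u IH] w /=; first by case: w.
by rewrite ev_skew_deriv_map //; apply: eq_ev.
Qed.

Lemma ev_unshuffle_map sig w phi : (forall i j, q (sig i) (sig j) = q i j) ->
  ev (unshuffle q (map sig w)) phi =
  ev (unshuffle q w) (fun c => phi (map sig c.1, map sig c.2)).
Proof.
move=> qsig; elim: w phi => [|i w IH] phi; first by rewrite !ev1.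
rewrite map_cons !ev_unshuffle_cons !IH; congr (_ + _).
by apply: eq_ev => c /=; rewrite big_map; congr (_ * _); apply: eq_bigr => l _.
Qed.

(** The map [phi] is braided: [chi_{sig j}(g_{sig i}) = chi_{sig j}(psi (g_i)) = chi_j(g_i)]. *)
Lemma admissible_qb lam sig psi : admissible g chi lam sig psi ->
  forall i j, q (sig i) (sig j) = q i j.
Proof. by case=> _ _ _ hg hchi i j; rewrite /qb -hg [chi j]hchi. Qed.

Lemma admissible_inv lam sig psi psi' :
  admissible g chi lam sig psi -> cancel psi psi' -> cancel psi' psi ->
  admissible g chi (fun i => (lam ((sig^-1)%g i))^-1) (sig^-1)%g psi'.
Proof.
case=> nz hD _ hg hchi psiK psi'K; split.
- by move=> i; rewrite invr_eq0.
- by move=> a b; apply: (can_inj psiK); rewrite hD !psi'K.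
- by exists psi.
- by move=> i; apply: (can_inj psiK); rewrite psi'K hg permKV.
- move=> i; rewrite -{1}[i](permKV sig); apply: functional_extensionality => a.
  by rewrite /= [in RHS]hchi /= psi'K.
Qed.

(** The scalar and the index on the right depend on [x] only, so coordinates pull back to multiples
    of coordinates. *)
Lemma coef_Phi lam sig psi psi' b x :
  (forall i j, q (sig i) (sig j) = q i j) -> cancel psi psi' -> cancel psi' psi ->
  ev (Phi lam sig psi b) (coef^~ x) =
  (\prod_(i <- map (sig^-1)%g x.2) lam i) * coef b (psi' x.1, map (sig^-1)%g x.2).
Proof.
move=> qsig psiK psi'K; rewrite /Phi ev1 /coef /= (can2_eq psiK psi'K).
rewrite -{1}(mapK (permKV sig) x.2) Om_map // [LHS]mulrCA [RHS]mulrCA.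
congr (_ * _); apply: (@Om_swap _ _ _ (fun w => \prod_(i <- w) lam i)).
by move=> w w'; apply: perm_big.
Qed.

Lemma Phi_well_defined lam sig psi :
  admissible g chi lam sig psi -> well_defined g chi (Phi lam sig psi).
Proof.
move=> adm; have qsig := admissible_qb adm; case: adm => _ _ [psi' psiK psi'K] _ _.
apply/well_definedE => x f /zeroAE z.
rewrite (eq_ev _ (fun b => coef_Phi lam b x qsig psiK psi'K)).
by rewrite evZl z mulr0.
Qed.

Lemma weight_map sig psi w : psi 0 = 0 -> {morph psi : a b / a + b} ->
  (forall i, psi (g i) = g (sig i)) -> weight g (map sig w) = psi (weight g w).
Proof.
move=> h0 hD hg; rewrite /weight big_map (big_morph psi hD h0).
by apply: eq_bigr => i _; rewrite hg.
Qed.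

Lemma Phi_hopf lam sig psi :
  admissible g chi lam sig psi -> is_hopf_aut g chi (Phi lam sig psi).
Proof.
move=> adm; have qsig := admissible_qb adm; split; first exact: Phi_well_defined.
have [nz hD [psi' psiK psi'K] hg hchi] := adm.
have h0 : psi 0 = 0 by apply: (addrI (psi 0)); rewrite -hD !addr0.
split.
- have adm' := admissible_inv adm psiK psi'K.
  exists (Phi (fun i => (lam ((sig^-1)%g i))^-1) (sig^-1)%g psi').
  split; first exact: Phi_well_defined adm'.
  + move=> b; apply/eqAE => x; rewrite /Phi ev_applyL !ev1 /= big_map.
    rewrite (mapK (permK sig)) psiK mulrA -big_split /= big1 => [|i _].
      by case: b.
    by rewrite permK divff.
  + move=> b; apply/eqAE => x; rewrite /Phi ev_applyL !ev1 /= big_map.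
    rewrite (mapK (permKV sig)) psi'K mulrA -big_split /= big1 => [|i _].
      by case: b.
    by rewrite mulVf.
- by apply/eqAE => x; rewrite ev_applyL !ev1 /= big_nil h0 mul1r.
- move=> b b'; apply/eqAE => x.
  rewrite ev_applyL ev_mulB ev_mulA !ev1 /= big_cat map_cat hD.
  have -> : chiw chi b'.1 b.2 = chiw chi (map sig b'.1) (psi b.2).
    by rewrite /chiw big_map; apply: eq_bigr => i _; rewrite hchi.
  by rewrite /= -!mulrA [LHS]mulrCA; congr (_ * _); exact: mulrCA.
- move=> b; apply/eqAAE => x y.
  rewrite ev_DeltaA ev1 ev_applyL2_coef !ev_DeltaB /= ev_unshuffle_map // -evZl.
  (* The letters of [b.1] are distributed over the two factors, and the product of the [lam i]
     splits accordingly. *)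
  apply: eq_ev_in => c /unshuffle_perm pe; rewrite !ev1 (perm_big _ pe) big_cat /=.
  by rewrite (weight_map _ h0 hD hg) -hD mulrACA.
by move=> [[|i w] a]; rewrite /epsA /Phi big_seq1 /epsB /= ?big_nil ?mulr1 ?mulr0.
Qed.

(** [lam] and [sig] are read off the images of the letters, where [lam i != 0] rules out a mismatch,
    and [psi] off the grouplikes. *)
Lemma Phi_inj lam sig psi lam' sig' psi' :
  admissible g chi lam sig psi ->
  eqL g chi (Phi lam sig psi) (Phi lam' sig' psi') ->
  [/\ lam =1 lam', sig = sig' & psi =1 psi'].
Proof.
move=> [nz _ _ _ _] e.
have letter i : lam i = lam' i /\ sig i = sig' i.
  have /eqAE/(_ (psi 0, [:: sig i])) := e ([:: i], 0).
  rewrite /Phi !ev1 /= !coef_letter !big_seq1 /= !eqxx !mulr1.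
  rewrite eqseq_cons andbT -natrM mulnb => eql.
  have [e0 | ne] := boolP ((psi' 0 == psi 0) && (sig i == sig' i)).
    by move: eql; rewrite e0 mulr1; case/andP: e0 => _ /eqP.
  by have := nz i; rewrite eql (negbTE ne) mulr0 eqxx.
split=> [i||a]; [exact: (letter i).1|by apply/permP => i; exact: (letter i).2|].
have /eqAE/(_ (psi a, [::])) := e ([::], a).
rewrite /Phi !ev1 /= !coef_nil !big_nil /= !eqxx !mulr1 !mul1r.
by case: eqP => // _ /eqP; rewrite oner_eq0.
Qed.

Lemma hopf_aut_Phi (F : linmap k G n) :
  (forall i, chi i <> (fun _ => 1)) ->
  (forall i j, i != j -> (g i, chi i) <> (g j, chi j)) ->
  is_hopf_aut g chi F ->
  exists lam sig psi, admissible g chi lam sig psi /\ eqL g chi F (Phi lam sig psi).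
Proof.
move=> nontriv distinct [wdF [[F' [wdF' FK F'K]] _ F_mul F_Delta _]].
have [psi [psiE psi_bij psiD]] := grouplike_aut wdF wdF' FK F'K F_mul F_Delta.
have nontriv' i : exists h, chi i h != 1.
  apply: NNPP => none; apply: (nontriv i); apply: functional_extensionality => h.
  by apply/eqP/negPn/negP => nz; apply: none; exists h.
have support i x (nz : ev (F ([:: i], 0)) (coef^~ x) != 0) :=
  F_letter_support F_mul F_Delta psiE psiD (nontriv' i) nz.
(* The image of [x_i] is nonzero and supported on letters. *)
have exj i : exists j, ev (F ([:: i], 0)) (coef^~ (0, [:: j])) != 0.
  have nz : coef ([:: i], 0) (0, [:: i]) != 0.
    by rewrite coef_letter !eqxx mulr1 oner_eq0.
  have [x nzx] := F_neq0 wdF' FK nz.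
  by have [j [ex _ _]] := support i x nzx; exists j; rewrite -ex.
pose s i := xchoose (exj i); have sP i := xchooseP (exj i).
have sgchi i : psi (g i) = g (s i) /\ chi i = chi (s i) \o psi.
  have [j [[<-] hg hchi]] := support i _ (sP i).
  by split=> //; apply: functional_extensionality.
have psi_inj : injective psi by exact: bij_inj.
have eq_index i j : g i = g j -> chi i = chi j -> i = j.
  move=> eg ec; apply/eqP/negPn/negP => /distinct; apply; by rewrite eg ec.
have s_inj : injective s.
  move=> i j eqs; apply: eq_index; last by rewrite (sgchi i).2 (sgchi j).2 eqs.
  by apply: psi_inj; rewrite (sgchi i).1 (sgchi j).1 eqs.
have [psi' psiK psi'K] := psi_bij.
(* Two letters in one image share their degree and, [psi] being onto, their character. *)
have single i j : ev (F ([:: i], 0)) (coef^~ (0, [:: j])) != 0 -> j = s i.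
  move=> /support[_ [[<-] hg hchi]]; apply: eq_index.
    by rewrite -hg (sgchi i).1.
  apply: functional_extensionality => h; rewrite -[h]psi'K -hchi.
  by rewrite (sgchi i).2.
pose lam i := ev (F ([:: i], 0)) (coef^~ (0, [:: s i])).
exists lam, (perm s_inj), psi; split.
  split=> // i; rewrite permE; [exact: (sgchi i).1|exact: (sgchi i).2].
have psi0 : psi 0 = 0 by apply: (addrI (psi 0)); rewrite -psiD !addr0.
have letter i : eqA g chi (F ([:: i], 0)) (Phi lam (perm s_inj) psi ([:: i], 0)).
  apply/eqAE => x; rewrite ev1 /= psi0 permE big_seq1 coef_letter.
  have [z|nz] := eqVneq (ev (F ([:: i], 0)) (coef^~ x)) 0; last first.
    have [j [ex _ _]] := support i x nz; rewrite ex in nz *.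
    by rewrite (single i j nz) /= !eqxx !mulr1.
  case: x z => x1 x2 z /=; case: (0 =P x1) => [e1|_]; last by rewrite mul0r mulr0.
  case: (x2 =P _) => [e2|_]; last by rewrite !mulr0.
  by rewrite -e1 e2 in z; have := sP i; rewrite -/(s i) z eqxx.
(* Letters and group elements generate, so agreement on them propagates along words by
   multiplicativity. *)
case=> w a; elim: w => [|i w IH].
  by apply/eqAE => x; rewrite psiE ev1 big_nil mul1r.
apply/eqAE => x.
have Fc : eqA g chi (F (i :: w, a)) (Defs.mulA chi (F ([:: i], 0)) (F (w, a))).
  apply/eqAE => y; have /eqAE/(_ y) <- := F_mul ([:: i], 0) (w, a).
  by rewrite ev_applyL ev_mulB chiw0 // mul1r /= add0r.
have /eqAE -> := Fc; have /eqAE -> := mulA_eqA (letter i) IH.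
rewrite /Phi ev_mulA !ev1 /= psi0 add0r chiw0 // mul1r.
by rewrite big_seq1 big_cons mulrA.
Qed.

End Monomial.

Theorem theorem1p6 (k : fieldType) (G : zmodType) (n : nat)
  (g : 'I_n -> G) (chi : 'I_n -> G -> k)
  (chi_mul : forall i a b, chi i (a + b) = chi i a * chi i b)
  (chi_0 : forall i, chi i 0 = 1)
  (chi_nontriv : forall i, chi i <> (fun _ => 1))
  (pairs_distinct : forall i j, i != j -> (g i, chi i) <> (g j, chi j)) :
  (forall lam sig psi, admissible g chi lam sig psi ->
     is_hopf_aut g chi (Phi lam sig psi))
  /\ (forall lam sig psi lam' sig' psi',
        admissible g chi lam sig psi -> admissible g chi lam' sig' psi' ->
        eqL g chi (Phi lam sig psi) (Phi lam' sig' psi') ->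
        [/\ lam =1 lam', sig = sig' & psi =1 psi'])
  /\ (forall F : linmap k G n, is_hopf_aut g chi F ->
        exists lam sig psi, admissible g chi lam sig psi /\
                            eqL g chi F (Phi lam sig psi)).
Proof.
split; first by move=> lam sig psi; apply: Phi_hopf.
split; last by move=> F; apply: hopf_aut_Phi.
by move=> lam sig psi lam' sig' psi' adm _; apply: Phi_inj.
Qed.
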